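(* Let $f:\mathbb{R}^d\to\mathbb{R}$ be twice differentiable, $L$-smooth, $\mu$-strongly convex and $M$-strongly self-concordant. Run the SR-$k$ method (with the randomized or the greedy strategy) with $k=d$ from $x_0\in\mathbb{R}^d$ such that $M\lambda(x_0)\le2$ and a symmetric positive definite $G_0\in\mathbb{R}^{d\times d}$ with $\nabla^2 f(x_0)\preceq G_0$. Then, almost surely, $\lambda(x_{t+1})\le M(\lambda(x_t))^2$ for all $t\ge1$.
   Context: Notation: $\preceq$ is the Loewner order on symmetric matrices; $\|\cdot\|$ is the Euclidean norm; $S^\dagger$ is the Moore–Penrose inverse; $\|v\|_z=(v^\top\nabla^2 f(z)v)^{1/2}$. Assumptions on $f$: $L$-smooth means $\|\nabla f(x)-\nabla f(y)\|\le L\|x-y\|$ for all $x,y$. $\mu$-strongly convex ($\mu>0$) means $f(\theta x+(1-\theta)y)\le\theta f(x)+(1-\theta)f(y)-\frac{\theta(1-\theta)\mu}{2}\|x-y\|^2$ for all $x,y$ and $\theta\in[0,1]$. $M$-strongly self-concordant ($M>0$) means $\nabla^2 f(y)-\nabla^2 f(x)\preceq M\|y-x\|_z\nabla^2 f(w)$ for all $x,y,z,w\in\mathbb{R}^d$. Local gradient norm: $\lambda(x)=\sqrt{\nabla f(x)^\top(\nabla^2 f(x))^{-1}\nabla f(x)}$. SR-$k$ update: for symmetric positive definite $A\preceq G$ in $\mathbb{R}^{d\times d}$ and $U\in\mathbb{R}^{d\times k}$, $$\text{SR-}k(G,A,U)=G-(G-A)U\big(U^\top(G-A)U\big)^\dagger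 U^\top(G-A).$$ For $B\in\mathbb{R}^{d\times d}$, $E_k(B)\in\mathbb{R}^{d\times k}$ is the matrix with columns $e_{i_1},\dots,e_{i_k}$ (standard basis vectors), where $i_1,\dots,i_k$ are the indices of the $k$ largest diagonal entries of $B$. SR-$k$ method: given (deterministic) $x_0,G_0,k$, for $t=0,1,\dots$: $x_{t+1}=x_t-G_t^{-1}\nabla f(x_t)$; $r_t=\|x_{t+1}-x_t\|_{x_t}$; $\tilde G_t=(1+Mr_t)G_t$; choose $U_t\in\mathbb{R}^{d\times k}$ by either the randomized strategy (entries i.i.d. $\mathcal{N}(0,1)$, independent across iterations) or the greedy strategy ($U_t=E_k(\tilde G_t-\nabla^2 f(x_{t+1}))$); set $G_{t+1}=\text{SR-}k(\tilde G_t,\nabla^2 f(x_{t+1}),U_t)$. *)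

(* Defs.v *)
From HB Require Import structures.
From mathcomp Require Import all_boot all_order all_algebra.
From mathcomp Require Import all_classical all_reals all_analysis.
Set Implicit Arguments.
Unset Strict Implicit.
Unset Printing Implicit Defensive.
Import Order.TTheory GRing.Theory Num.Theory.
Import numFieldNormedType.Exports.
Local Open Scope classical_set_scope.
Local Open Scope ring_scope.

Section LinearAlgebra.
Variable R : realType.

Definition qform (d : nat) (A : 'M[R]_d) (v : 'cV[R]_d) : R :=
  (v^T *m A *m v) 0 0.

(* The norm `|v| of the library on matrices is the sup norm. *)
Definition enorm (d : nat) (v : 'cV[R]_d) : R :=
  Num.sqrt (\sum_(i < d) v i 0 ^+ 2).

Definition loewner_le (d : nat) (A B : 'M[R]_d) : Prop :=
  [/\ A^T = A, B^T = B & forall v : 'cV[R]_d, 0 <= qform (B - A) v].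

Definition sym_posdef (d : nat) (A : 'M[R]_d) : Prop :=
  A^T = A /\ forall v : 'cV[R]_d, v != 0 -> 0 < qform A v.

Definition is_moore_penrose (m n : nat) (A : 'M[R]_(m, n)) (X : 'M[R]_(n, m))
    : Prop :=
  [/\ A *m X *m A = A, X *m A *m X = X,
      (A *m X)^T = A *m X & (X *m A)^T = X *m A].

(* The default value 0 is never used: see pinvP and pinv_unique. *)
Definition pinv (m n : nat) (A : 'M[R]_(m, n)) : 'M[R]_(n, m) :=
  xget 0 [set X | is_moore_penrose A X].

Lemma gram_unit (r n : nat) (A : 'M[R]_(r, n)) :
  row_free A -> A *m A^T \in unitmx.
Proof.
move=> fA; rewrite -row_free_unit -kermx_eq0.
set K := kermx _; have KA : K *m A *m (K *m A)^T = 0.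
  by rewrite trmx_mul !mulmxA -(mulmxA K) mulmx_ker mul0mx.
have KA0 : K *m A = 0.
  apply/matrixP => i j; rewrite [RHS]mxE.
  have /eqP : (K *m A *m (K *m A)^T) i i = 0 by rewrite KA mxE.
  rewrite mxE; under eq_bigr do rewrite [X in _ * X]mxE -expr2.
  rewrite psumr_eq0 => [/allP/(_ j)|? _]; last exact: sqr_ge0.
  by rewrite mem_index_enum sqrf_eq0 => /(_ isT)/eqP.
by apply/eqP/(row_free_inj fA); rewrite KA0 mul0mx.
Qed.

Lemma pinvP (m n : nat) (A : 'M[R]_(m, n)) : is_moore_penrose A (pinv A).
Proof.
have [r [C [B [uB uC <-]]]] :
    exists r : nat, exists C : 'M[R]_(m, r), exists B : 'M[R]_(r, n),
      [/\ B *m B^T \in unitmx, C^T *m C \in unitmx & C *m B = A].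
  exists (\rank A), (col_base A), (row_base A).
  split; last exact: mulmx_base.
    exact/gram_unit/row_base_free.
  rewrite -{2}[col_base A]trmxK; apply: gram_unit.
  by rewrite /row_free mxrank_tr; exact: col_base_full.
rewrite /pinv; case: xgetP => [//|noX]; exfalso.
set X := B^T *m invmx (B *m B^T) *m (invmx (C^T *m C) *m C^T).
have AX : C *m B *m X = C *m invmx (C^T *m C) *m C^T.
  by rewrite /X !mulmxA -(mulmxA C) -(mulmxA C (B *m B^T)) mulmxV// mulmx1.
have XA : X *m (C *m B) = B^T *m invmx (B *m B^T) *m B.
  rewrite /X -!mulmxA; congr (_ *m (_ *m _)).
  by rewrite (mulmxA C^T) mulKmx.
apply: (noX X); split.
- by rewrite AX -!mulmxA (mulmxA C^T) mulKmx.
- by rewrite XA /X -!mulmxA (mulmxA B) mulKVmx.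
- by rewrite AX !trmx_mul trmxK trmx_inv trmx_mul trmxK mulmxA.
- by rewrite XA !trmx_mul trmxK trmx_inv trmx_mul trmxK mulmxA.
Qed.

Lemma pinv_unique (m n : nat) (A : 'M[R]_(m, n)) (X : 'M[R]_(n, m)) :
  is_moore_penrose A X -> X = pinv A.
Proof.
have := pinvP A; set Y := pinv A => -[Y1 Y2 Y3 Y4] [X1 X2 X3 X4].
have AXY : A *m X = A *m Y.
  by rewrite -X3 -{1}Y1 -(mulmxA (A *m Y)) trmx_mul X3 Y3 mulmxA X1.
have XAY : X *m A = Y *m A.
  by rewrite -X4 -{1}Y1 -!mulmxA mulmxA trmx_mul X4 Y4 -mulmxA (mulmxA A) X1.
by rewrite -X2 XAY -mulmxA AXY mulmxA.
Qed.

Definition srk (d k : nat) (G A : 'M[R]_d) (U : 'M[R]_(d, k)) : 'M[R]_d :=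
  G - (G - A) *m U *m pinv (U^T *m (G - A) *m U) *m U^T *m (G - A).

(* U is a possible value of E_k(B): its columns are the standard basis vectors
   indexed by s 0, ..., s (k-1), which are distinct indices of k largest
   diagonal entries of B. This is a relation because neither the choice among
   tied diagonal entries nor the order of the columns is fixed. *)
Definition is_greedy_mx (d k : nat) (B : 'M[R]_d) (U : 'M[R]_(d, k)) : Prop :=
  exists s : 'I_k -> 'I_d,
    [/\ injective s,
        forall (i : 'I_d) (j : 'I_k), (forall l, s l != i) ->
          B i i <= B (s j) (s j)
      & U = \matrix_(i, j) (i == s j)%:R].

End LinearAlgebra.

Section Functions.
Variables (R : realType) (d : nat).
Implicit Types (f : 'cV[R]_d -> R) (x y z w v : 'cV[R]_d).

Definition grad f x : 'cV[R]_d := \col_i 'D_(delta_mx i 0) f x.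

Definition hess f x : 'M[R]_d :=
  \matrix_(i, j) 'D_(delta_mx j 0) (fun y => grad f y i 0) x.

Definition twice_differentiable f : Prop :=
  (forall x, differentiable f x) /\ (forall x, differentiable (grad f) x).

Definition smooth_fun (L : R) f : Prop :=
  forall x y, enorm (grad f x - grad f y) <= L * enorm (x - y).

Definition strongly_convex (mu : R) f : Prop :=
  forall x y (theta : R), 0 <= theta <= 1 ->
    f (theta *: x + (1 - theta) *: y) <=
      theta * f x + (1 - theta) * f y
      - theta * (1 - theta) * mu / 2 * enorm (x - y) ^+ 2.

Definition local_norm f z v : R := Num.sqrt (qform (hess f z) v).

Definition strongly_self_concordant (M : R) f : Prop :=
  forall x y z w,
    loewner_le (hess f y - hess f x) ((M * local_norm f z (y - x)) *: hess f w).

Definition local_grad_norm f x : R :=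
  Num.sqrt (qform (invmx (hess f x)) (grad f x)).

Definition corrected f (M : R) (x : nat -> 'cV[R]_d) (G : nat -> 'M[R]_d)
    (t : nat) : 'M[R]_d :=
  (1 + M * local_norm f (x t) (x t.+1 - x t)) *: G t.

Definition is_srk_run (k : nat) f (M : R) (x0 : 'cV[R]_d) (G0 : 'M[R]_d)
    (x : nat -> 'cV[R]_d) (G : nat -> 'M[R]_d) (U : nat -> 'M[R]_(d, k))
    : Prop :=
  [/\ x 0%N = x0, G 0%N = G0,
      forall t, x t.+1 = x t - invmx (G t) *m grad f (x t)
    & forall t, G t.+1 = srk (corrected f M x G t) (hess f (x t.+1)) (U t)].

Definition greedy_strategy (k : nat) f (M : R)
    (x : nat -> 'cV[R]_d) (G : nat -> 'M[R]_d) (U : nat -> 'M[R]_(d, k))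
    : Prop :=
  forall t, is_greedy_mx (corrected f M x G t - hess f (x t.+1)) (U t).

End Functions.

Section Probability.
Variables (R : realType) (disp : measure_display) (Omega : measurableType disp).
Variable P : probability Omega R.

Definition mutually_independent (I : choiceType) (X : I -> {RV P >-> R})
    : Prop :=
  forall (s : seq I) (B : I -> set R), uniq s ->
    (forall i, measurable (B i)) ->
    P (\bigcap_(i in [set` s]) (X i @^-1` B i)) =
    (\prod_(i <- s) P (X i @^-1` B i))%E.

(* Independence is over all triples (t, i, j), that is, over the entries of each
   matrix and across the iterations. *)
Definition randomized_strategy (d k : nat) (U : nat -> Omega -> 'M[R]_(d, k))
    : Prop :=
  exists X : nat * 'I_d * 'I_k -> {RV P >-> R},
    [/\ forall t omega i j, U t omega i j = X (t, i, j) omega,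
        forall a (B : set R), measurable B ->
          distribution P (X a) B = normal_prob 0 1 B
      & mutually_independent X].

End Probability.

(* Main.v *)
Require Import Defs.
From HB Require Import structures.
From mathcomp Require Import all_boot all_order all_algebra.
From mathcomp Require Import all_classical all_reals all_analysis.
From mathcomp Require Import measurable_realfun.
From mathcomp Require Import ring lra.
Set Implicit Arguments.
Unset Strict Implicit.
Unset Printing Implicit Defensive.
Import Order.TTheory GRing.Theory Num.Theory.
Import numFieldNormedType.Exports.
Local Open Scope classical_set_scope.
Local Open Scope ring_scope.

(** Why the theorem holds.

    When U is square and invertible, U (U^T B U)^+ U^T is a generalized inverse
    of B = G - A, so the SR-k update returns the target A whatever G is
    ([srk_unitmx]). Hence, as soon as all the U_t are invertible, G_t is the
    Hessian at x_t for every t >= 1, and each later step is an exact Newton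
    step.

    A Newton step satisfies lambda(x+) <= (M/2) lambda(x)^2 ([newton_step]).
    The usual proof bounds v^T (H(x + s h) - H(x)) h by the Cauchy-Schwarz
    inequality for a single Hessian H(w), and then pays a factor for comparing
    the Hessians at the two ends of the step. This factor is avoided by letting
    v be the displacement and h the argument of the quadratic form: up to an
    error o(t) as t tends to 0,
      t (v^T grad f(x + h) - v^T grad f(x) - h^T H(x) v)
    is the second-order Taylor remainder along h of the function
    y |-> f(y + t v) - f(y), whose second derivative
    h^T (H(y + t v) - H(y)) h is at most t M |v|_z |h|_w^2 for any z and w
    ([grad_remainder_le]). Taking w = x, z = x+ and v = H(x+)^-1 grad f(x+)
    turns the remainder into lambda(x+)^2 <= (M/2) lambda(x+) lambda(x)^2.

    It remains to see that the U_t are almost surely invertible. The greedy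
    choice of d indices out of d gives a permutation matrix ([greedy_unitmx]).
    A Gaussian matrix is singular with probability zero ([det_negligible]), by
    induction on the size: its determinant is D X + b, where X is the top left
    entry and D and b are functions of the other entries. Given these, D X + b
    vanishes for a single value of X unless D = 0; as X has no atoms and is
    independent of (D, b), Fubini's theorem shows that this has probability
    zero ([affine_null]), and D is the determinant of a smaller Gaussian
    matrix. *)

(** * The full-rank update *)

Section FullRankUpdate.
Variable R : realType.

(** The Moore-Penrose identity C C^+ C = C for C = U^T B U can be cancelled on
    both sides by the invertible U^T and U, which leaves
    B (U C^+ U^T) B = B. *)
Lemma srk_unitmx (d : nat) (G A U : 'M[R]_d) : U \in unitmx -> srk G A U = A.
Proof.
move=> uU; rewrite /srk; set B := G - A; set C := U^T *m B *m U.
suff -> : B *m U *m Defs.pinv C *m U^T *m B = B by rewrite opprB addrC subrK.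
have uUT : U^T \in unitmx by rewrite unitmx_tr.
have [CXC _ _ _] := Defs.pinvP C.
apply: (can_inj (mulKmx uUT)); apply: (can_inj (mulmxK uU)).
by rewrite -[RHS]CXC /C !mulmxA.
Qed.

Lemma greedy_unitmx (d : nat) (B U : 'M[R]_d) :
  is_greedy_mx B U -> U \in unitmx.
Proof.
move=> [s [s_inj _ ->]]; set E := \matrix_(i, j) _.
suff UU : E^T *m E = 1%:M by case/mulmx1_unit: UU.
apply/matrixP => j k; rewrite !mxE (bigD1 (s j)) //= !mxE eqxx mul1r.
rewrite (inj_eq s_inj) big1 ?addr0// => i /negPf ne.
by rewrite !mxE ne mul0r.
Qed.

End FullRankUpdate.

(** * Inner products and quadratic forms *)

Section InnerProduct.
Variables (R : realType) (d : nat).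
Implicit Types (u v w : 'cV[R]_d) (A B : 'M[R]_d).

Definition dotv u v : R := (u^T *m v) 0 0.

Lemma dotvE u v : dotv u v = \sum_(i < d) u i 0 * v i 0.
Proof. by rewrite /dotv mxE; apply: eq_bigr => i _; rewrite mxE. Qed.

Lemma dotvC u v : dotv u v = dotv v u.
Proof. by rewrite !dotvE; apply: eq_bigr => i _; rewrite mulrC. Qed.

Lemma dotvDr u v w : dotv u (v + w) = dotv u v + dotv u w.
Proof. by rewrite /dotv mulmxDr mxE. Qed.

Lemma dotvNr u v : dotv u (- v) = - dotv u v.
Proof. by rewrite /dotv mulmxN mxE. Qed.

Lemma dotvZr (c : R) u v : dotv u (c *: v) = c * dotv u v.
Proof. by rewrite /dotv -scalemxAr mxE. Qed.

Lemma dotvNl u v : dotv (- u) v = - dotv u v.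
Proof. by rewrite dotvC dotvNr dotvC. Qed.

Lemma dotvZl (c : R) u v : dotv (c *: u) v = c * dotv u v.
Proof. by rewrite dotvC dotvZr dotvC. Qed.

Lemma dotv_gt0 v : v != 0 -> 0 < dotv v v.
Proof.
have v2_ge0 (i : 'I_d) : 0 <= v i 0 * v i 0 by rewrite -expr2 sqr_ge0.
move=> v0; rewrite lt_neqAle eq_sym dotvE sumr_ge0// andbT.
apply: contra v0 => /eqP/psumr_eq0P v0; apply/eqP/matrixP => i j.
by rewrite ord1 mxE; apply/eqP; rewrite -sqrf_eq0 expr2 v0.
Qed.

Lemma sqr_enorm v : enorm v ^+ 2 = dotv v v.
Proof.
rewrite /enorm sqr_sqrtr ?sumr_ge0// => [|i _]; last exact: sqr_ge0.
by rewrite dotvE; apply: eq_bigr => i _; rewrite expr2.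
Qed.

Lemma qformE A v : qform A v = dotv v (A *m v).
Proof. by rewrite /qform /dotv mulmxA. Qed.

Lemma qformZ A (c : R) v : qform A (c *: v) = c ^+ 2 * qform A v.
Proof. by rewrite !qformE -scalemxAr dotvZr dotvZl mulrA expr2. Qed.

Lemma qformBl A B v : qform (A - B) v = qform A v - qform B v.
Proof. by rewrite !qformE mulmxBl dotvDr dotvNr. Qed.

Lemma qformZl A (c : R) v : qform (c *: A) v = c * qform A v.
Proof. by rewrite !qformE -scalemxAl dotvZr. Qed.

Lemma posdef_unitmx A :
  (forall v, v != 0 -> 0 < qform A v) -> A \in unitmx.
Proof.
move=> Apos; rewrite -unitmx_tr -row_free_unit -kermx_eq0.
apply/eqP/row_matrixP => i; rewrite row0; apply/eqP; apply: contraT => Ki0.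
have : 0 < qform A (row i (kermx A^T))^T.
  by apply: Apos; rewrite -(inj_eq trmx_inj) trmxK trmx0.
have KA : A *m (row i (kermx A^T))^T = 0.
  by apply: trmx_inj; rewrite trmx_mul trmxK -row_mul mulmx_ker row0 trmx0.
by rewrite qformE KA dotvC /dotv trmx0 mul0mx mxE ltxx.
Qed.

End InnerProduct.

(** * Derivatives along a line *)

Section LineDerivatives.
Variables (R : realType) (d : nat).
Implicit Types (f : 'cV[R]_d -> R) (x y v h : 'cV[R]_d).

Lemma is_derive_line (W : normedModType R) (F : 'cV[R]_d -> W) x v (s : R) :
  differentiable F (x + s *: v) ->
  is_derive s 1 (fun t : R => F (x + t *: v)) ('d F (x + s *: v) v).
Proof.
move=> dF.
have dl : is_diff s (fun t : R => x + t *: v) (0 + *:%R^~ v : R -> 'cV[R]_d).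
  exact: (@is_diffD _ _ _ (cst x) (fun t : R => t *: v)).
have dF' : is_diff (x + s *: v) F ('d F (x + s *: v)) by apply: DiffDef.
have [dd ed] := @is_diff_comp _ _ _ _ (fun t : R => x + t *: v) _ F _ s dl dF'.
apply: DeriveDef; first exact: diff_derivable.
by rewrite deriveE// ed /= add0r scale1r.
Qed.

Lemma vec_sum_delta v : v = \sum_(i < d) v i 0 *: delta_mx i 0.
Proof.
by rewrite {1}[v]matrix_sum_delta; apply: eq_bigr => i _; rewrite big_ord1.
Qed.

Lemma diff_grad f y v : differentiable f y -> 'd f y v = dotv v (grad f y).
Proof.
move=> df; rewrite {1}[v]vec_sum_delta linear_sum dotvE; apply: eq_bigr => i _.
by rewrite linearZ /= mxE deriveE.
Qed.

Lemma diff_hess f y v : differentiable (grad f) y ->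
  'd (grad f) y v = hess f y *m v.
Proof.
move=> df; rewrite {1}[v]vec_sum_delta linear_sum /=.
apply/matrixP => i j; rewrite ord1 summxE [RHS]mxE; apply: eq_bigr => k _.
rewrite linearZ /= !mxE mulrC; congr (_ * _).
rewrite -deriveE// derive_mx ?mxE //; exact: diff_derivable.
Qed.

Lemma is_derive_fun_line f x v (s : R) : (forall y, differentiable f y) ->
  is_derive s 1 (fun t : R => f (x + t *: v)) (dotv v (grad f (x + s *: v))).
Proof. by move=> df; rewrite -diff_grad//; exact: is_derive_line. Qed.

Lemma is_derive_grad_line f x v h (s : R) :
  (forall y, differentiable (grad f) y) ->
  is_derive s 1 (fun t : R => dotv h (grad f (x + t *: v)))
    (dotv h (hess f (x + s *: v) *m v)).
Proof.
move=> df; rewrite -diff_hess//.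
have := is_derive_line (df (x + s *: v)).
move: ('d _ _ v) => D HD.
rewrite (_ : (fun t => _) =
  \sum_(i < d) (fun t : R => h i 0 *: grad f (x + t *: v) i 0)).
  rewrite dotvE; apply: is_derive_sum => i; apply: is_deriveZ.
  have [dF eF] := HD.
  apply: DeriveDef; first exact: (derivable_mxP _ _ _).1.
  by rewrite -eF derive_mx// mxE.
by apply/funext => t; rewrite dotvE fct_sumE.
Qed.

Lemma is_derive_qform_line f x v (s : R) :
  (forall y, differentiable (grad f) y) ->
  is_derive s 1 (fun t : R => dotv v (grad f (x + t *: v)))
    (qform (hess f (x + s *: v)) v).
Proof. by move=> df; rewrite qformE; exact: is_derive_grad_line. Qed.

End LineDerivatives.

(** * Two one-variable estimates *)

(** Only the existence of the second derivative is assumed, so the remainder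
    cannot be written as an integral; the mean value theorem is applied to p'
    and then to p minus the quadratic C s^2 / 2 + p'(0) s. *)
Lemma taylor2_le (R : realType) (p p' p'' : R -> R) (C : R) :
  (forall s : R, is_derive s 1 p (p' s)) ->
  (forall s : R, is_derive s 1 p' (p'' s)) ->
  (forall s, p'' s <= C) -> p 1 - p 0 - p' 0 <= C / 2.
Proof.
move=> dp dp' leC.
have ctn (q q' : R -> R) a b : (forall s : R, is_derive s 1 q (q' s)) ->
    {within `[a, b], continuous q}.
  move=> dq; apply: derivable_within_continuous => s _.
  by have [] := dq s.
pose q : R -> R :=
  p - ((C / 2) *: ((id : R -> R) ^+ 2) + p' 0 *: (id : R -> R)).
have qE s : q s = p s - (C / 2 * s ^+ 2 + p' 0 * s) by [].
have dq (s : R) : is_derive s 1 q (p' s - (C * s + p' 0)).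
  have did2 := @is_deriveX _ _ (id : R -> R) 2 s 1 1 (is_derive_id _ _).
  have dq := is_deriveB (dp s) (is_deriveD
    (is_deriveZ (C / 2) did2) (is_deriveZ (p' 0) (is_derive_id s 1))).
  apply: (is_derive_eq dq).
  by rewrite /GRing.scale /= expr1; field.
have [c /[!in_itv]/= /andP[c0 c1] qc] :=
  MVT ltr01 (fun s _ => dq s) (ctn _ _ 0 1 dq).
have [e /[!in_itv]/= /andP[e0 e1] p'c] :=
  MVT c0 (fun s _ => dp' s) (ctn _ _ 0 c dp').
have : q 1 - q 0 <= 0.
  have := ler_wpM2r (ltW c0) (leC e).
  by rewrite qc; move: p'c; rewrite !subr0 mulr1; lra.
rewrite !qE; lra.
Qed.

(** The quadratic term s^2 K absorbs the error made by applying a convexity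
    inequality at distance s instead of infinitesimally. *)
Lemma derive0_le (R : realType) (p : R -> R) (D C K : R) :
  is_derive (0 : R) (1 : R) p D ->
  (forall s, 0 < s <= 1 -> p s - p 0 <= s * (C + s * K)) -> D <= C.
Proof.
move=> [dp <-] le_p.
have cvgD : (h^-1 *: ((p \o shift 0) (h *: (1 : R)) - p 0)) @[h --> (0 : R)^'+]
    --> 'D_1 p 0.
  exact/cvg_dnbhs_at_right/dp.
apply/ler_addgt0Pr => e e0; apply: (cvgr_to_le cvgD).
have K0 : 0 < `|K| + 1 by rewrite ltr_wpDl.
near=> h.
have h0 : 0 < h by near: h; exact: nbhs_right_gt.
have h1 : h <= 1 by near: h; exact: nbhs_right_le.
have he : h <= e / (`|K| + 1) by near: h; apply: nbhs_right_le; rewrite divr_gt0.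
rewrite /= addr0 /GRing.scale /= mulr1 ler_pdivrMl//.
rewrite (le_trans (le_p _ _)) ?h0//= ler_pM2l// lerD2l.
rewrite (le_trans (ler_norm _))// normrM (gtr0_norm h0).
have heK : h * (`|K| + 1) <= e by rewrite -ler_pdivlMr.
by apply: le_trans heK; rewrite ler_pM2l// lerDl.
Unshelve. all: by end_near. Qed.

(** * Strong convexity *)

Section StronglyConvex.
Variables (R : realType) (d : nat) (f : 'cV[R]_d -> R) (mu : R).
Hypotheses (f2 : twice_differentiable f) (fmu : strongly_convex mu f).
Implicit Types x v : 'cV[R]_d.

Lemma strongly_convex_grad x v :
  dotv v (grad f x) <= f (x + v) - f x - mu / 2 * dotv v v.
Proof.
pose N := mu / 2 * dotv v v.
have df := is_derive_fun_line x v 0 f2.1; rewrite scale0r addr0 in df.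
apply: (derive0_le (K := N) df) => s /andP[s0 s1].
have -> : x + s *: v = s *: (x + v) + (1 - s) *: x.
  by rewrite scalerDr scalerBl scale1r [RHS]addrC addrA subrK.
have := fmu (x + v) x (theta := s); rewrite ltW//= => /(_ s1).
rewrite sqr_enorm scale0r addr0 (addrC x v) addrK.
rewrite /N; lra.
Qed.

(** Adding the first-order inequality at x and at x + s v gives
    s v^T (grad f(x + s v) - grad f(x)) >= mu s^2 |v|^2. *)
Lemma strongly_convex_hess x v : mu * dotv v v <= qform (hess f x) v.
Proof.
have df := is_derive_grad_line x v (- v) 0 f2.2.
rewrite scale0r addr0 in df.
rewrite -lerN2 qformE -dotvNl.
apply: (derive0_le (K := 0) df) => s /andP[s0 s1].
rewrite mulr0 addr0 scale0r addr0 !dotvNl.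
have := strongly_convex_grad x (s *: v).
have := strongly_convex_grad (x + s *: v) (- (s *: v)).
rewrite addrK dotvNr !dotvNl opprK dotvZr !dotvZl.
move=> h1 h2; rewrite -(ler_pM2l s0); lra.
Qed.

Lemma hess_posdef (mu0 : 0 < mu) x v : v != 0 -> 0 < qform (hess f x) v.
Proof.
move=> v0; apply: lt_le_trans (strongly_convex_hess _ _).
by rewrite mulr_gt0// dotv_gt0.
Qed.

End StronglyConvex.

(** * Newton steps under strong self-concordance *)

(* Derivatives at two different points are kept as atoms: unification would
   otherwise compare them by unfolding them down to limits. *)
#[local] Opaque hess grad.

Section SelfConcordant.
Variables (R : realType) (d : nat) (f : 'cV[R]_d -> R) (mu M : R).
Hypothesis f2 : twice_differentiable f.
Hypotheses (mu0 : 0 < mu) (fmu : strongly_convex mu f).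
Hypotheses (M0 : 0 < M) (fM : strongly_self_concordant M f).
Implicit Types x v h z w : 'cV[R]_d.

Let hess_pos x v : v != 0 -> 0 < qform (hess f x) v.
Proof. exact: (hess_posdef f2 fmu). Qed.

Let hess_nneg x v : 0 <= qform (hess f x) v.
Proof.
have [->|v0] := eqVneq v 0; last exact/ltW/hess_pos.
by rewrite qformE mulmx0 /dotv mulmx0 mxE.
Qed.

(** The Loewner order compares symmetric matrices only, so self-concordance
    between x and some y <> x says that a positive multiple of the Hessian at x
    is symmetric; this replaces Schwarz's theorem. *)
Lemma hess_sym x : (hess f x)^T = hess f x.
Proof.
have [/eqP d0|/pred0Pn[i _]] := boolP (#|'I_d| == 0)%N.
  by apply/matrixP => i; have := card0_eq d0 i; rewrite inE.
pose v : 'cV[R]_d := delta_mx i 0.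
have v0 : v != 0.
  by apply/eqP => /matrixP/(_ i 0)/eqP; rewrite !mxE !eqxx oner_eq0.
have [_ + _] := fM x (x + v) x x.
rewrite (addrC x v) addrK linearZ /=; apply: scalerI.
by rewrite mulf_neq0 ?gt_eqF// sqrtr_gt0 hess_pos.
Qed.

Lemma local_normZ z (c : R) v : 0 <= c ->
  local_norm f z (c *: v) = c * local_norm f z v.
Proof.
by move=> c0; rewrite /local_norm qformZ sqrtrM ?sqr_ge0// sqrtr_sqr ger0_norm.
Qed.

(** If f is three times differentiable, this integrates the third derivative
    in the directions (h, h, v), and by its symmetry v may be taken as the
    direction in which the Hessian varies, so that self-concordance bounds it
    with no Cauchy-Schwarz inequality. With two derivatives only, that
    symmetry is replaced by exchanging the two differences in
    f(x + h + t v) - f(x + h) - f(x + t v) + f(x). *)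
Lemma grad_remainder_le x h v z w :
  dotv v (grad f (x + h)) - dotv v (grad f x) - dotv h (hess f x *m v) <=
  M / 2 * local_norm f z v * qform (hess f w) h.
Proof.
(* The left-hand side is the derivative at t = 0 of the first-order Taylor
   remainder f(x + h + t v) - f(x + t v) - h^T grad f(x + t v). *)
have dp := is_deriveB (is_deriveB (is_derive_fun_line (x + h) v 0 f2.1)
   (is_derive_fun_line x v 0 f2.1)) (is_derive_grad_line x v h 0 f2.2).
rewrite !scale0r !addr0 in dp.
apply: (derive0_le (K := 0) dp) => t /andP[t0 _]; rewrite mulr0 addr0.
rewrite !fctE !scale0r !addr0.
(* The increment of that remainder between 0 and t is itself the remainder
   along h of s |-> f(x + t v + s h) - f(x + s h). *)
have dq s := is_deriveB (is_derive_fun_line (x + t *: v) h s f2.1)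
  (is_derive_fun_line x h s f2.1).
have dq' s := is_deriveB (is_derive_qform_line (x + t *: v) h s f2.2)
  (is_derive_qform_line x h s f2.2).
have /(taylor2_le dq dq') : forall s,
    qform (hess f (x + t *: v + s *: h)) h - qform (hess f (x + s *: h)) h
    <= t * (M * local_norm f z v * qform (hess f w) h).
  move=> s; have [_ _ /(_ h)] := fM (x + s *: h) (x + t *: v + s *: h) z w.
  rewrite (addrAC x) [x + _ + _ - _]addrC addKr (local_normZ _ _ (ltW t0)).
  rewrite !qformBl qformZl subr_ge0 => /le_trans; apply.
  by rewrite !mulrA (mulrC M t).
rewrite !fctE !scale0r !scale1r !addr0 (addrAC x).
lra.
Qed.

(** In [grad_remainder_le], the Newton direction h makes - v^T grad f(x) and
    - h^T H(x) v cancel, and v = H(x + h)^-1 grad f(x + h) turns both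
    v^T grad f(x + h) and |v|^2 at x + h into the square of the new local
    gradient norm. *)
Lemma newton_step x :
  local_grad_norm f (x - invmx (hess f x) *m grad f x)
    <= M / 2 * local_grad_norm f x ^+ 2.
Proof.
set h := - (invmx _ *m _).
have uH y : hess f y \in unitmx by apply: posdef_unitmx; exact: hess_pos.
have local_gradE y : qform (invmx (hess f y)) (grad f y) =
    qform (hess f y) (invmx (hess f y) *m grad f y).
  by rewrite !qformE mulKVmx// dotvC.
pose g := grad f (x + h); pose v := invmx (hess f (x + h)) *m g.
have := grad_remainder_le x h v (x + h) x.
have -> : dotv h (hess f x *m v) = dotv v (- grad f x).
  have <- : hess f x *m h = - grad f x by rewrite /h mulmxN mulKVmx.
  by rewrite dotvC /dotv trmx_mul hess_sym -mulmxA.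
rewrite dotvNr opprK subrK.
have -> : qform (hess f x) h = local_grad_norm f x ^+ 2.
  rewrite sqr_sqrtr local_gradE ?hess_nneg//.
  by rewrite /h -scaleN1r qformZ sqrrN expr1n mul1r.
have -> : local_norm f (x + h) v = local_grad_norm f (x + h).
  by rewrite /local_norm /local_grad_norm local_gradE.
have -> : dotv v g = local_grad_norm f (x + h) ^+ 2.
  by rewrite sqr_sqrtr local_gradE ?hess_nneg// qformE mulKVmx.
set l := local_grad_norm f (x + h).
have : 0 <= l by exact: sqrtr_ge0.
rewrite le_eqVlt => /predU1P[<- _|l0].
  by rewrite mulr_ge0 ?sqr_ge0// divr_ge0// ltW.
by rewrite expr2 [M / 2 * l]mulrC -(mulrA l) ler_pM2l.
Qed.

End SelfConcordant.

(** * Determinants *)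

Lemma measurable_det (R : realType) (disp : measure_display)
    (T : measurableType disp) (n : nat) (A : T -> 'M[R]_n) :
  (forall i j, measurable_fun setT (fun t => A t i j)) ->
  measurable_fun setT (fun t => \det (A t)).
Proof.
move=> mA; apply: measurable_sum => s; apply: measurable_funM => //.
by apply: measurable_prod => i _.
Qed.

(** The expansions along the first row of A and of A with its top left entry
    set to zero have the same cofactors. *)
Lemma det_affine_corner (R : comRingType) (n : nat) (A : 'M[R]_n.+1) :
  \det A =
    A ord0 ord0 * \det (\matrix_(i < n, j < n) A (lift ord0 i) (lift ord0 j)) +
    \det (\matrix_(i, j) if (i == ord0) && (j == ord0) then 0 else A i j).
Proof.
set B := (X in _ + \det X).
rewrite (expand_det_row A ord0) (expand_det_row B ord0) big_ord_recl.
rewrite [in RHS]big_ord_recl [B ord0 ord0]mxE !eqxx mul0r add0r.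
have cofE j : cofactor A ord0 j = cofactor B ord0 j.
  rewrite /cofactor; congr (_ * \det _).
  by apply/matrixP => i k; rewrite !mxE.
congr (_ + _); last by apply: eq_bigr => j _; rewrite cofE [B _ _]mxE.
rewrite /cofactor expr0 mul1r; congr (_ * \det _).
by apply/matrixP => i k; rewrite !mxE.
Qed.

(** * Matrices with independent atomless entries are almost surely invertible *)

Section Independence.
Variables (R : realType) (disp : measure_display) (Omega : measurableType disp).
Variables (P : probability Omega R) (I : choiceType) (X : I -> {RV P >-> R}).
Hypothesis indepX : mutually_independent X.

(** A pi-system that generates the sigma-algebra of the variables indexed by s.
    As s is the same for all its members, it is closed under intersection
    coordinate by coordinate. *)
Definition cylinders (s : seq I) : set (set Omega) :=
  [set A | exists2 B : I -> set R, (forall i, measurable (B i)) &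
     A = \bigcap_(i in [set` s]) (X i @^-1` B i)].

Lemma setI_closed_cylinders s : setI_closed (cylinders s).
Proof.
move=> _ _ [B mB ->] [C mC ->]; exists (fun i => B i `&` C i).
  by move=> i; exact: measurableI.
rewrite -bigcapI; apply: eq_bigcapr => i _; exact: preimage_setI.
Qed.

Lemma measurable_cylinders s : <<s cylinders s >> `<=` (@measurable _ Omega).
Proof.
apply: smallest_sub; first exact: sigma_algebra_measurable.
move=> _ [B mB ->]; apply: fin_bigcap_measurable; first exact: finite_seq.
by move=> i _; rewrite -[X in measurable X]setTI; exact: measurable_funPT.
Qed.

Lemma coordinate_measurable s i : i \in s ->
  measurable_fun (setT : set (g_sigma_algebraType (cylinders s))) (X i).
Proof.
move=> si _ C mC; rewrite setTI; apply: sub_sigma_algebra.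
exists (fun j => if j == i then C else setT); first by move=> j; case: ifP.
apply/seteqP; split=> w /=; last by move=> /(_ i si) /=; rewrite eqxx.
by move=> Cw j _ /=; case: eqP => // ->.
Qed.

Local Open Scope ereal_scope.

(** The sets A for which the product rule holds form a lambda-system, which
    contains the cylinders by mutual independence, hence their sigma-algebra by
    the pi-lambda theorem. *)
Lemma cylinders_indep s a (C : set R) A : uniq s -> a \notin s ->
  measurable C -> <<s cylinders s >> A ->
  P (A `&` X a @^-1` C) = P A * P (X a @^-1` C).
Proof.
move=> us nas mC.
have mXC : measurable (X a @^-1` C).
  by rewrite -[X in measurable X]setTI; exact: measurable_funPT.
pose H := [set A | measurable A /\
  P (A `&` X a @^-1` C) = P A * P (X a @^-1` C)].
suff : <<s cylinders s >> `<=` H by move=> /[apply] -[].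
apply: lambda_system_subset => //; first exact: setI_closed_cylinders.
  split=> //.
  - by split=> //; rewrite setTI probability_setT mul1e.
  - move=> B D DB [mB PB] [mD PD]; split; first exact: measurableD.
    have PD_sub (Y Z : set Omega) : measurable Y -> measurable Z -> Z `<=` Y ->
        P (Y `\` Z) = P Y - P Z.
      move=> mY mZ ZY; rewrite measureD ?ltey_eq ?fin_num_measure//.
      by rewrite setIidr.
    have -> : (B `\` D) `&` X a @^-1` C =
        (B `&` X a @^-1` C) `\` (D `&` X a @^-1` C).
      rewrite eqEsubset; split=> o /= [].
        by move=> [Bo nDo] Co; split => // -[].
      by move=> [Bo Co] nDCo; do 2!split => //; move=> Do; exact: nDCo.
    rewrite PD_sub; [|exact: measurableI|exact: measurableI|exact: setSI].
    rewrite PD_sub// PB PD muleBl ?fin_num_measure//.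
    by rewrite fin_num_adde_defl// fin_numN fin_num_measure.
  - move=> F ndF HF.
    have mF i : measurable (F i) by have [] := HF i.
    split; first exact: bigcup_measurable.
    rewrite setI_bigcupl.
    have mFC i : measurable (F i `&` X a @^-1` C) by exact: measurableI.
    have ndFC : nondecreasing_seq (fun n => F n `&` X a @^-1` C).
      move=> m n mn; rewrite subsetEset; apply: setSI.
      by rewrite -subsetEset; exact: ndF.
    have cvgFC := nondecreasing_cvg_mu (mu := P) mFC
      (bigcup_measurable (fun n _ => mFC n)) ndFC.
    have cvgF := nondecreasing_cvg_mu (mu := P) mF
      (bigcup_measurable (fun n _ => mF n)) ndF.
    apply: (cvg_unique _ cvgFC) => //.
    have PXC : P (X a @^-1` C) \is a fin_num by rewrite fin_num_measure.
    apply: cvg_trans (cvgeZr PXC cvgF).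
    by apply: near_eq_cvg; apply: nearW => n; case: (HF n) => _ /= ->.
move=> _ [B mB ->]; split.
  by apply: (@measurable_cylinders s); apply: sub_sigma_algebra; exists B.
(* As a is not in s, the event of X a joins the others as one more coordinate
   of a single family of Borel sets. *)
have XB : \bigcap_(i in [set` s]) (X i @^-1` B i) = \bigcap_(i in [set` s])
    (X i @^-1` (fun i => if i == a then C else B i) i).
  apply: eq_bigcapr => i /= si; case: eqP => // ia.
  by rewrite ia (negPf nas) in si.
have := @indepX (a :: s) (fun i => if i == a then C else B i).
rewrite /= nas us => /(_ isT).
have -> : [set` a :: s] = a |` [set` s].
  by apply/seteqP; split=> i /=; rewrite inE => /predU1P.
rewrite big_cons eqxx bigcap_setU1 /= eqxx setIC -XB => -> //; last first.
  by move=> i; case: ifP.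
rewrite muleC; congr (_ * _).
rewrite indepX// [LHS]big_seq [RHS]big_seq; apply: eq_bigr => i si.
by case: eqP => // ia; rewrite ia (negPf nas) in si.
Qed.

(** By independence, the law of w |-> (w, X a w), with w seen through the
    sigma-algebra of the variables in s only, is a product measure. The set
    where D y + b = 0 and D <> 0 has sections with at most one point, which the
    law of X a does not charge. *)
Lemma affine_null s a (D b : Omega -> R) : uniq s -> a \notin s ->
  (forall x : R, P (X a @^-1` [set x]) = 0) ->
  measurable_fun (setT : set (g_sigma_algebraType (cylinders s))) D ->
  measurable_fun (setT : set (g_sigma_algebraType (cylinders s))) b ->
  P.-negligible [set w | D w != 0%R /\ (D w * X a w + b w = 0)%R].
Proof.
move=> us nas X0 mD mb.
pose T' := g_sigma_algebraType (cylinders s).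
have mid : measurable_fun (setT : set Omega) (id : Omega -> T').
  by move=> _ A mA; rewrite setTI; exact: measurable_cylinders mA.
pose idm : {mfun Omega >-> T'} := HB.pack (id : Omega -> T')
  (isMeasurableFun.Build _ _ _ _ (id : Omega -> T') mid).
pose m1 := distribution P idm.
pose m2 := distribution P (X a).
pose g (w : Omega) : (T' * R)%type := (w, X a w).
have mg : measurable_fun setT g.
  by apply: measurable_fun_pair => //; exact: measurable_funPT.
pose gm : {mfun Omega >-> (T' * R)%type} := HB.pack g
  (isMeasurableFun.Build _ _ _ _ g mg).
pose m' := distribution P gm.
pose E : set (T' * R) :=
  [set z | D z.1 != 0%R] `&` [set z | D z.1 * z.2 + b z.1 = 0]%R.
have mE : measurable E.
  have mD1 : measurable_fun setT (fun z : (T' * R)%type => D z.1).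
    exact: (measurableT_comp mD).
  have mb1 : measurable_fun setT (fun z : (T' * R)%type => b z.1).
    exact: (measurableT_comp mb).
  have mDb : measurable_fun setT
      (fun z : (T' * R)%type => (D z.1 * z.2 + b z.1)%R).
    by apply: measurable_funD => //; exact: measurable_funM.
  have m0 : measurable [set (0 : R)%R] by exact: measurable_set1.
  apply: measurableI.
    rewrite (_ : [set _ | _] =
      (fun z : (T' * R)%type => D z.1) @^-1` (~` [set 0%R])).
      by rewrite -[X in measurable X]setTI; apply: mD1 => //;
         exact: measurableC.
    by apply/seteqP; split=> z /= /eqP.
  by have := mDb measurableT _ m0; rewrite setTI.
exists (g @^-1` E); split=> //.
  by rewrite -[X in measurable X]setTI; apply: (mg measurableT).
have rect A B : measurable A -> measurable B -> m' (A `*` B) = m1 A * m2 B.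
  move=> mA mB; rewrite /m1 /m2 /m' /distribution /pushforward /=.
  by rewrite -(cylinders_indep us nas mB mA); congr (P _).
transitivity ((m1 \x m2) E).
  exact/esym/(@product_measure_unique _ _ _ _ _ m1 m2 m' rect).
apply: integral0_eq => w _ /=.
have [Dw0|Dw0] := eqVneq (D w) 0%R.
  rewrite (_ : xsection E w = set0) ?measure0//.
  apply/seteqP; split=> // y; rewrite /xsection /= inE => -[/=].
  by rewrite Dw0 eqxx.
apply/eqP; rewrite -measure_le0 -(X0 (- b w / D w)%R).
apply: (@le_measure _ _ _ m2); rewrite ?inE.
- exact: measurable_xsection.
- exact: measurable_set1.
move=> y; rewrite /xsection /= inE => -[/= _ /eqP].
by rewrite addr_eq0 => /eqP <-; rewrite mulrC mulKf.
Qed.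

(** Allowing any injective indexing idx of the entries makes the induction
    hypothesis apply to the minor obtained by deleting the first row and
    column. *)
Lemma det_negligible n (idx : 'I_n -> 'I_n -> I) :
  (forall i j i' j', idx i j = idx i' j' -> i = i' /\ j = j') ->
  (forall a (x : R), P (X a @^-1` [set x]) = 0) ->
  P.-negligible [set w | \det (\matrix_(i, j) X (idx i j) w) = 0%R].
Proof.
move=> idx_inj X0; elim: n idx idx_inj => [|n IHn] idx idx_inj.
  apply: (negligibleS _ (negligible_set0 P)) => w /=.
  by rewrite det_mx00 => /eqP; rewrite oner_eq0.
pose D w := \det (\matrix_(i < n, j < n) X (idx (lift ord0 i) (lift ord0 j)) w).
pose b w := \det (\matrix_(i, j)
  if (i == ord0) && (j == ord0) then 0 else X (idx i j) w)%R.
pose s := [seq idx p.1 p.2 |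
  p <- enum [pred p : 'I_n.+1 * 'I_n.+1 | p != (ord0, ord0)]].
have sP i j : (i, j) != (ord0, ord0) -> idx i j \in s.
  by move=> ij; apply/mapP; exists (i, j); rewrite ?mem_enum.
have us : uniq s.
  rewrite map_inj_in_uniq ?enum_uniq// => -[i j] [i' j'] _ _ /=.
  by move=> /idx_inj[-> ->].
have nas : idx ord0 ord0 \notin s.
  apply/mapP => -[[i j]]; rewrite mem_enum inE => + /idx_inj /= [i0 j0].
  by rewrite -i0 -j0 eqxx.
have mD : measurable_fun (setT : set (g_sigma_algebraType (cylinders s))) D.
  apply: measurable_det => i j; under eq_fun do rewrite mxE.
  by apply: coordinate_measurable; exact: sP.
have mb : measurable_fun (setT : set (g_sigma_algebraType (cylinders s))) b.
  apply: measurable_det => i j; under eq_fun do rewrite mxE.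
  have [_|ij] := boolP ((i == ord0) && (j == ord0)).
    exact: measurable_cst.
  by apply: coordinate_measurable; apply: sP; rewrite xpair_eqE.
have D0 : P.-negligible [set w | D w = 0%R].
  by apply: IHn => i j i' j' /idx_inj[/lift_inj -> /lift_inj ->].
have Db0 := affine_null us nas (X0 _) mD mb.
apply: (negligibleS _ (negligibleU D0 Db0)) => w /=.
have [|Dw] := eqVneq (D w) 0%R; first by left.
rewrite det_affine_corner mxE mulrC => detw; right; split=> //.
rewrite -[RHS]detw; congr (_ * _ + _)%R.
  by congr (\det _); apply/matrixP => i j; rewrite !mxE.
by congr (\det _); apply/matrixP => i j; rewrite !mxE.
Qed.

End Independence.

Lemma normal_prob_set1 (R : realType) (x : R) :
  normal_prob 0 1 [set x] = 0%E.
Proof.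
have /null_content_dominatesP := normal_prob_dominates (0 : R) 1.
by apply; [exact: measurable_set1|exact: lebesgue_measure_set1].
Qed.

Lemma randomized_unitmx (R : realType) (disp : measure_display)
    (Omega : measurableType disp) (P : probability Omega R) (d : nat)
    (U : nat -> Omega -> 'M[R]_(d, d)) :
  randomized_strategy P U -> {ae P, forall w, forall t, U t w \in unitmx}.
Proof.
move=> [X [UX XN indepX]]; apply: ae_foralln => t.
have X0 a (y : R) : P (X a @^-1` [set y]) = 0%E.
  by rewrite -[LHS]/(distribution P (X a) [set y]) XN ?normal_prob_set1.
pose idx (i j : 'I_d) := (t, i, j).
have idx_inj i j i' j' : idx i j = idx i' j' -> i = i' /\ j = j' by case.
apply: (negligibleS _ (det_negligible indepX idx_inj X0)) => w /=.
rewrite unitmxE unitfE => /negP; rewrite negbK => /eqP detU.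
by rewrite -[RHS]detU; congr (\det _); apply/matrixP => i j; rewrite mxE UX.
Qed.

(** * The run with full-rank updates *)

Theorem corollary4p6 (R : realType) (d : nat) (f : 'cV[R]_d -> R) (L mu M : R)
    (x0 : 'cV[R]_d) (G0 : 'M[R]_d)
    (disp : measure_display) (Omega : measurableType disp)
    (P : probability Omega R)
    (x : nat -> Omega -> 'cV[R]_d) (G : nat -> Omega -> 'M[R]_d)
    (U : nat -> Omega -> 'M[R]_(d, d)) :
  twice_differentiable f ->
  smooth_fun L f ->
  0 < mu -> strongly_convex mu f ->
  0 < M -> strongly_self_concordant M f ->
  M * local_grad_norm f x0 <= 2 ->
  sym_posdef G0 ->
  loewner_le (hess f x0) G0 ->
  (forall omega, is_srk_run f M x0 G0 (x ^~ omega) (G ^~ omega) (U ^~ omega)) ->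
  randomized_strategy P U \/
  (forall omega, greedy_strategy f M (x ^~ omega) (G ^~ omega) (U ^~ omega)) ->
  {ae P, forall omega, forall t : nat, (1 <= t)%N ->
    local_grad_norm f (x t.+1 omega)
      <= M * local_grad_norm f (x t omega) ^+ 2}.
Proof.
move=> f2 _ mu0 fmu M0 fM _ _ _ run strategy.
have : {ae P, forall w, forall t, U t w \in unitmx}.
  case: strategy => [|greedy]; first exact: randomized_unitmx.
  by apply: (@aeW _ _ _ P) => w t; exact: greedy_unitmx (greedy w t).
apply: filterS => w uU [//|t] _.
have [_ _ xS GS] := run w.
rewrite xS GS srk_unitmx//.
apply: le_trans (newton_step f2 mu0 fmu M0 fM _) _.
by rewrite ler_wpM2r ?sqr_ge0// ler_pdivrMr// ler_peMr ?ler1n// ltW.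
Qed.
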